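(* Let $n\ge 1$ and let $\alpha_i,\psi_i,\varphi_i$ ($i=1,\dots,n$) and $\nu$ be real numbers. Let $(P)$, $(D)$, $\Pi^d$, $\Pi_0^d$, $\sigma_0$, $I$, $J$ be as defined in the context. Suppose the supremum $\Pi_0^d$ of the dual problem $(D)$ is attained when $\sigma$ approaches $\sigma_0$, i.e. $\Pi_0^d=\lim_{\sigma\to\sigma_0^+}\Pi^d(\sigma)$. Then every global optimal solution of $(P)$, with $w$-component $w^*=(w_1^*,\dots,w_n^* )$, satisfies $$w_j^*=\frac{\psi_j+\sigma_0\varphi_j}{\alpha_j+\sigma_0}\quad\text{for all } j\in J,$$ $$\sum_{i\in I}\Big(\tfrac12 (w_i^* )^2-\varphi_i w_i^*\Big)=-\sum_{j\in J}\Big(\tfrac12 (w_j^* )^2-\varphi_j w_j^*\Big)+\sigma_0+\nu .$$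
   Context: The canonical primal problem is $$(P)\qquad \min\Big\{\tfrac12\xi^2+\sum_{i=1}^n\big(\tfrac12\alpha_i w_i^2-\psi_i w_i\big)\ :\ (\xi,w)\in\mathbb{R}\times\mathbb{R}^n,\ \xi=\Lambda(w)\Big\},\qquad \Lambda(w)=\sum_{i=1}^n\big(\tfrac12 w_i^2-\varphi_i w_i\big)-\nu .$$ Let $\sigma_0=\max\{-\alpha_1,\dots,-\alpha_n\}$. The canonical dual problem is $$(D)\qquad \Pi_0^d=\sup_{\sigma\in(\sigma_0,+\infty)}\Pi^d(\sigma),\qquad \Pi^d(\sigma)=-\tfrac12\sigma^2-\tfrac12\sum_{i=1}^n\frac{(\psi_i+\sigma\varphi_i)^2}{\alpha_i+\sigma}-\nu\sigma .$$ The index sets are $I=\{i\in\{1,\dots,n\}:\alpha_i+\sigma_0=0\}$ (which is nonempty) and $J=\{1,\dots,n\}\setminus I$, so that $\alpha_j+\sigma_0>0$ for $j\in J$. *)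

(* Defs.v *)
From HB Require Import structures.
From mathcomp Require Import all_boot all_order all_algebra.
From mathcomp Require Import all_classical all_reals all_analysis.
Set Implicit Arguments.
Unset Strict Implicit.
Unset Printing Implicit Defensive.
Import Order.TTheory GRing.Theory Num.Theory.
Import numFieldNormedType.Exports.
Local Open Scope ring_scope.

Section CanonicalDuality.
Variables (R : realType) (n : nat).
Implicit Types (alpha psi phi w : 'rV[R]_n) (nu xi sigma : R).

Definition Lambda phi nu w : R :=
  \sum_(i < n) (2^-1 * w 0 i ^+ 2 - phi 0 i * w 0 i) - nu.

Definition primal_objective alpha psi (p : R * 'rV[R]_n) : R :=
  2^-1 * p.1 ^+ 2
  + \sum_(i < n) (2^-1 * alpha 0 i * p.2 0 i ^+ 2 - psi 0 i * p.2 0 i).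

Definition primal_feasible phi nu : set (R * 'rV[R]_n) :=
  [set p | p.1 = Lambda phi nu p.2]%classic.

Definition primal_global_optimum alpha psi phi nu (p : R * 'rV[R]_n) : Prop :=
  primal_feasible phi nu p /\
  forall q, primal_feasible phi nu q ->
    primal_objective alpha psi p <= primal_objective alpha psi q.

(* The nonemptiness proof only serves to seed the
   iterated maximum with one of the values it ranges over. *)
Definition sigma0 (n_gt0 : (0 < n)%N) alpha : R :=
  \big[Num.max/ - alpha 0 (Ordinal n_gt0)]_(i < n) - alpha 0 i.

Definition dual_objective alpha psi phi nu sigma : R :=
  - (2^-1 * sigma ^+ 2)
  - 2^-1 * (\sum_(i < n) (psi 0 i + sigma * phi 0 i) ^+ 2
                         / (alpha 0 i + sigma))
  - nu * sigma.

Definition dual_value (n_gt0 : (0 < n)%N) alpha psi phi nu : \bar R :=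
  ereal_sup [set (dual_objective alpha psi phi nu sigma)%:E
            | sigma in [set` `]sigma0 n_gt0 alpha, +oo[ ]]%classic.

Definition index_I (n_gt0 : (0 < n)%N) alpha : {set 'I_n} :=
  [set i | alpha 0 i + sigma0 n_gt0 alpha == 0]%SET.

Definition index_J (n_gt0 : (0 < n)%N) alpha : {set 'I_n} :=
  (~: index_I n_gt0 alpha)%SET.

End CanonicalDuality.

(* Main.v *)
Require Import Defs.
From HB Require Import structures.
From mathcomp Require Import all_boot all_order all_algebra.
From mathcomp Require Import all_classical all_reals all_analysis.
From mathcomp Require Import ring lra.
Set Implicit Arguments.
Unset Strict Implicit.
Unset Printing Implicit Defensive.
Import Order.TTheory GRing.Theory Num.Theory.
Import numFieldNormedType.Exports.
Local Open Scope classical_set_scope.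
Local Open Scope ring_scope.

(** By Fenchel's equality, the primal objective at [w] is
    [lagrangian sigma w + (Lambda w - sigma)^2 / 2] for every [sigma], and
    [dual_objective sigma] is the minimum over [w] of [lagrangian sigma w] when
    [sigma > sigma0].  If the supremum of the dual is its limit at [sigma0], then
    [dual_objective sigma <= lagrangian sigma0 w] for all [sigma > sigma0] and
    all [w].  Letting [w] run along the axes of [I] forces
    [psi_i + sigma0 phi_i = 0] on [I], so [lagrangian sigma0] is minimized by the
    point [v] equal to [phi] on [I] and to the claimed values on [J].  Comparing
    first orders in [sigma - sigma0] gives [Lambda v <= sigma0]; moving [v]
    along an axis of [I] does not change [lagrangian sigma0], and makes [Lambda]
    equal to [sigma0].  Hence the primal value is [lagrangian sigma0 v], and both
    nonnegative terms [lagrangian sigma0 w - lagrangian sigma0 v] and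
    [(Lambda w - sigma0)^2 / 2] vanish at an optimum. *)

(** The primal objective with [xi^2 / 2] replaced by its Fenchel minorant
    [sigma * Lambda w - sigma^2 / 2], regrouped as a separable quadratic in [w]. *)
Definition lagrangian (R : realType) (n : nat) (alpha psi phi : 'rV[R]_n)
    (nu sigma : R) (w : 'rV[R]_n) : R :=
  - (2^-1 * sigma ^+ 2) - nu * sigma
  + \sum_(i < n) (2^-1 * (alpha 0 i + sigma) * w 0 i ^+ 2
                  - (psi 0 i + sigma * phi 0 i) * w 0 i).

Lemma primal_objective_lagrangian (R : realType) (n : nat)
    (alpha psi phi : 'rV[R]_n) (nu sigma : R) (w : 'rV[R]_n) :
  primal_objective alpha psi (Lambda phi nu w, w)
  = lagrangian alpha psi phi nu sigma w
    + 2^-1 * (Lambda phi nu w - sigma) ^+ 2.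
Proof.
rewrite /primal_objective /lagrangian /=.
have -> : \sum_(i < n) (2^-1 * (alpha 0 i + sigma) * w 0 i ^+ 2
                        - (psi 0 i + sigma * phi 0 i) * w 0 i)
  = \sum_(i < n) (2^-1 * alpha 0 i * w 0 i ^+ 2 - psi 0 i * w 0 i)
    + sigma * (Lambda phi nu w + nu).
  rewrite /Lambda subrK mulr_sumr -big_split /=.
  by apply: eq_bigr => i _; ring.
by field.
Qed.

(** Weak duality, by completing the square in each coordinate. *)
Lemma dual_le_lagrangian (R : realType) (n : nat) (alpha psi phi : 'rV[R]_n)
    (nu sigma : R) (w : 'rV[R]_n) :
  (forall i, 0 < alpha 0 i + sigma) ->
  dual_objective alpha psi phi nu sigma <= lagrangian alpha psi phi nu sigma w.
Proof.
move=> a_gt0; rewrite /dual_objective /lagrangian addrAC lerD2l mulr_sumr -sumrN.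
apply: ler_sum => i _; rewrite -subr_ge0.
set a := alpha 0 i + sigma; set b := psi 0 i + sigma * phi 0 i.
have a0 : a != 0 by rewrite lt0r_neq0 ?a_gt0.
have -> : 2^-1 * a * w 0 i ^+ 2 - b * w 0 i - - (2^-1 * (b ^+ 2 / a))
          = 2^-1 * a * (w 0 i - b / a) ^+ 2 by field.
by apply: mulr_ge0 (sqr_ge0 _); rewrite mulr_ge0 ?invr_ge0 // ltW ?a_gt0.
Qed.

Lemma alphaD_sigma0_ge0 (R : realType) (n : nat) (n_gt0 : (0 < n)%N)
    (alpha : 'rV[R]_n) (i : 'I_n) : 0 <= alpha 0 i + sigma0 n_gt0 alpha.
Proof.
rewrite -lerBlDl sub0r /sigma0.
exact: (le_bigmax _ (fun j => - alpha 0 j)).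
Qed.

Lemma index_I_neq0 (R : realType) (n : nat) (n_gt0 : (0 < n)%N)
    (alpha : 'rV[R]_n) : exists i, i \in index_I n_gt0 alpha.
Proof.
have [i e] : exists i, sigma0 n_gt0 alpha = - alpha 0 i.
  rewrite /sigma0.
  apply: (big_ind (fun x => exists i, x = - alpha 0 i)).
  - by exists (Ordinal n_gt0).
  - by move=> x y [i ->] [j ->]; case: leP => _; [exists j|exists i].
  - by move=> i _; exists i.
by exists i; rewrite inE e subrr.
Qed.

Lemma cvg_lagrangian (R : realType) (n : nat) (alpha psi phi : 'rV[R]_n)
    (nu : R) (w : 'rV[R]_n) (sigma : R) :
  lagrangian alpha psi phi nu x w @[x --> sigma]
  --> lagrangian alpha psi phi nu sigma w.
Proof.
pose A := \sum_(i < n) (2^-1 * alpha 0 i * w 0 i ^+ 2 - psi 0 i * w 0 i).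
(* Pulling [x] out of the sum leaves a quadratic polynomial in [x]. *)
have E x : lagrangian alpha psi phi nu x w
           = - (2^-1 * x ^+ 2) - nu * x + (A + x * (Lambda phi nu w + nu)).
  rewrite /lagrangian; congr (_ + _).
  rewrite /Lambda subrK mulr_sumr -big_split /=.
  by apply: eq_bigr => i _; ring.
rewrite E; under eq_fun do rewrite E.
apply: cvgD; [apply: cvgB|apply: cvgD; [exact: cvg_cst|]].
- by apply: cvgN; apply: (cvgM (cvg_cst _)); apply: cvgM; exact: cvg_id.
- by apply: (cvgM (cvg_cst _)); exact: cvg_id.
- by apply: (cvgM _ (cvg_cst _)); exact: cvg_id.
Qed.

(** A dual value is at most the supremum, which is the limit at [sigma0]; weak duality passes to
    that limit. *)
Lemma dual_le_lagrangian_sigma0 (R : realType) (n : nat) (n_gt0 : (0 < n)%N)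
    (alpha psi phi : 'rV[R]_n) (nu : R) :
  (dual_objective alpha psi phi nu sigma)%:E
    @[sigma --> (sigma0 n_gt0 alpha)^'+] --> dual_value n_gt0 alpha psi phi nu ->
  forall (sigma : R) (w : 'rV[R]_n), sigma0 n_gt0 alpha < sigma ->
  dual_objective alpha psi phi nu sigma
  <= lagrangian alpha psi phi nu (sigma0 n_gt0 alpha) w.
Proof.
move=> cvg_dual sigma w s_gt; rewrite -lee_fin.
apply: (@le_trans _ _ (dual_value n_gt0 alpha psi phi nu)).
  by apply: ereal_sup_ubound; exists sigma => //; rewrite /= inE /= in_itv /= s_gt.
have cvg_lag : (lagrangian alpha psi phi nu x w)%:E
    @[x --> (sigma0 n_gt0 alpha)^'+]
    --> (lagrangian alpha psi phi nu (sigma0 n_gt0 alpha) w)%:E.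
  apply: cvg_EFin; first by near=> x.
  exact/cvg_at_right_filter/cvg_lagrangian.
rewrite -(cvg_lim _ cvg_dual) // -(cvg_lim _ cvg_lag) //.
apply: lee_lim; [by apply/cvg_ex; eexists; exact: cvg_dual|
                 by apply/cvg_ex; eexists; exact: cvg_lag|].
near=> x; rewrite lee_fin; apply: dual_le_lagrangian => i.
apply: (le_lt_trans (alphaD_sigma0_ge0 n_gt0 alpha i)).
by rewrite ltrD2l; near: x; exact: nbhs_right_gt.
Unshelve. all: by end_near. Qed.

Lemma sum_delta (R : realType) (n : nat) (i : 'I_n) (f g : 'I_n -> R) :
  (forall j, j != i -> f j = g j) ->
  \sum_(j < n) f j = \sum_(j < n) g j + (f i - g i).
Proof.
move=> fg; rewrite (bigD1 i) //= [in RHS](bigD1 i) //=.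
by rewrite (eq_bigr _ fg); ring.
Qed.

(** The quadratic coefficient along axis [i] vanishes, so only the linear term changes. *)
Lemma lagrangian_shift (R : realType) (n : nat) (alpha psi phi : 'rV[R]_n)
    (nu sigma : R) (w : 'rV[R]_n) (i : 'I_n) (c : R) :
  alpha 0 i + sigma = 0 ->
  lagrangian alpha psi phi nu sigma (w + c *: delta_mx 0 i)
  = lagrangian alpha psi phi nu sigma w - (psi 0 i + sigma * phi 0 i) * c.
Proof.
move=> a0; rewrite /lagrangian.
rewrite (@sum_delta _ _ i _ (fun j => 2^-1 * (alpha 0 j + sigma) * w 0 j ^+ 2
                  - (psi 0 j + sigma * phi 0 j) * w 0 j)) => [|j ji].
  by rewrite !mxE !eqxx a0 /=; ring.
by rewrite !mxE (negPf ji) andbF mulr0 addr0.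
Qed.

(** The [i]-th summand is critical at [phi 0 i], so there is no term linear in [c]. *)
Lemma Lambda_shift (R : realType) (n : nat) (phi : 'rV[R]_n) (nu : R)
    (w : 'rV[R]_n) (i : 'I_n) (c : R) :
  w 0 i = phi 0 i ->
  Lambda phi nu (w + c *: delta_mx 0 i) = Lambda phi nu w + 2^-1 * c ^+ 2.
Proof.
move=> wi; rewrite /Lambda.
rewrite (@sum_delta _ _ i _ (fun j => 2^-1 * w 0 j ^+ 2 - phi 0 j * w 0 j)).
  by rewrite !mxE !eqxx wi /=; field.
by move=> j ji; rewrite !mxE (negPf ji) andbF mulr0 addr0.
Qed.

Lemma linear_residual_eq0 (R : realType) (n : nat) (alpha psi phi : 'rV[R]_n)
    (nu sigma M : R) (i : 'I_n) :
  (forall w, M <= lagrangian alpha psi phi nu sigma w) ->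
  alpha 0 i + sigma = 0 -> psi 0 i + sigma * phi 0 i = 0.
Proof.
move=> M_le a0; apply/eqP/negPn/negP => b0.
set b := psi 0 i + _ in b0.
(* This shift brings the affine function of [c] down to [M - 1]. *)
pose c := (lagrangian alpha psi phi nu sigma 0 - M + 1) / b.
have := M_le (0 + c *: delta_mx 0 i).
rewrite lagrangian_shift // -/b mulrC divfK //; lra.
Qed.

(** Exact Taylor expansion at a critical point [v]. *)
Lemma lagrangian_min (R : realType) (n : nat) (alpha psi phi : 'rV[R]_n)
    (nu sigma : R) (v w : 'rV[R]_n) :
  (forall i, psi 0 i + sigma * phi 0 i = (alpha 0 i + sigma) * v 0 i) ->
  lagrangian alpha psi phi nu sigma w
  = lagrangian alpha psi phi nu sigma v
    + \sum_(i < n) 2^-1 * (alpha 0 i + sigma) * (w 0 i - v 0 i) ^+ 2.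
Proof.
move=> bE; rewrite /lagrangian -[RHS]addrA; congr (_ + _).
by rewrite -big_split /=; apply: eq_bigr => i _; rewrite bE; field.
Qed.

(* When [a = 0] the hypothesis forces [phi = v], and the last term is [0 / 0 = 0]. *)
Lemma dual_summand_le (R : realType) (a phi v t : R) :
  0 <= a -> 0 < t -> (a = 0 -> v = phi) ->
  (a * v + t * phi) ^+ 2 / (a + t)
  <= a * v ^+ 2 + t * (2 * phi * v - v ^+ 2) + t ^+ 2 * ((phi - v) ^+ 2 / a).
Proof.
move=> a_ge0 t_gt0 va; have at0 : a + t != 0 by rewrite lt0r_neq0 ?ltr_wpDl.
(* An exact expansion in [t]; only the denominator of its remainder is then weakened from [a + t] to
   [a]. *)
have -> : (a * v + t * phi) ^+ 2 / (a + t)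
  = a * v ^+ 2 + t * (2 * phi * v - v ^+ 2) + t ^+ 2 * ((phi - v) ^+ 2 / (a + t)).
  by field.
rewrite lerD2l; apply: ler_wpM2l; first exact: sqr_ge0.
have [/eqP a0|a_neq0] := boolP (a == 0).
  by rewrite va // subrr expr0n !mul0r.
have a_gt0 : 0 < a by rewrite lt0r a_neq0.
by apply: ler_wpM2l; rewrite ?sqr_ge0 // lef_pV2 ?posrE ?addr_gt0 // lerDl ltW.
Qed.

(** First-order expansion of the dual to the right of [sigma], with slope [Lambda v - sigma] and an
    explicit quadratic error. *)
Lemma dual_ge_first_order (R : realType) (n : nat) (alpha psi phi : 'rV[R]_n)
    (nu sigma t : R) (v : 'rV[R]_n) :
  (forall i, 0 <= alpha 0 i + sigma) -> 0 < t ->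
  (forall i, psi 0 i + sigma * phi 0 i = (alpha 0 i + sigma) * v 0 i) ->
  (forall i, alpha 0 i + sigma = 0 -> v 0 i = phi 0 i) ->
  lagrangian alpha psi phi nu sigma v + t * (Lambda phi nu v - sigma)
  - t ^+ 2 * (2^-1 * (1 + \sum_(i < n) (phi 0 i - v 0 i) ^+ 2
                                       / (alpha 0 i + sigma)))
  <= dual_objective alpha psi phi nu (sigma + t).
Proof.
move=> a_ge0 t_gt0 bE va.
have term_le i : (psi 0 i + (sigma + t) * phi 0 i) ^+ 2 / (alpha 0 i + (sigma + t))
    <= (alpha 0 i + sigma) * v 0 i ^+ 2
       + t * (2 * phi 0 i * v 0 i - v 0 i ^+ 2)
       + t ^+ 2 * ((phi 0 i - v 0 i) ^+ 2 / (alpha 0 i + sigma)).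
  rewrite mulrDl !addrA bE; apply: dual_summand_le => //; exact: va.
have := ler_sum (index_enum _) (fun i (_ : true) => term_le i).
rewrite /dual_objective big_split /= big_split /= -!mulr_sumr.
set D := \sum_(i < n) _ / _; set C := \sum_(i < n) _ / _.
have -> : lagrangian alpha psi phi nu sigma v
  = - (2^-1 * sigma ^+ 2) - nu * sigma
    - 2^-1 * \sum_(i < n) (alpha 0 i + sigma) * v 0 i ^+ 2.
  rewrite /lagrangian mulr_sumr -sumrN; congr (_ + _).
  by apply: eq_bigr => i _; rewrite bE; field.
have -> : \sum_(i < n) (2 * phi 0 i * v 0 i - v 0 i ^+ 2)
  = - 2 * (Lambda phi nu v + nu).
  by rewrite /Lambda subrK mulr_sumr; apply: eq_bigr => i _; field.
set A := \sum_(i < n) _; set L := Lambda _ _ _ => D_le.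
nra.
Qed.

Lemma le0_of_le_scaled (R : realType) (x C : R) :
  (forall t, 0 < t -> t * x <= t ^+ 2 * C) -> x <= 0.
Proof.
move=> xC; rewrite leNgt; apply/negP => x_gt0.
have C_gt0 : 0 < C.
  by have := xC 1 ltr01; rewrite expr1n !mul1r; exact: lt_le_trans.
(* At this [t] the right-hand side is half of the left-hand side. *)
have t_gt0 : 0 < x / (2 * C) by rewrite divr_gt0 ?mulr_gt0.
have := xC _ t_gt0.
have -> : (x / (2 * C)) ^+ 2 * C = (x / (2 * C)) * x / 2.
  by field; rewrite lt0r_neq0.
by have := mulr_gt0 t_gt0 x_gt0; lra.
Qed.

Theorem theorem1 (R : realType) (n : nat) (n_gt0 : (0 < n)%N)
    (alpha psi phi : 'rV[R]_n) (nu : R)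
    (dual_sup_at_sigma0 :
       (dual_objective alpha psi phi nu sigma)%:E
         @[sigma --> (sigma0 n_gt0 alpha)^'+]
       --> dual_value n_gt0 alpha psi phi nu)
    (xi : R) (w : 'rV[R]_n)
    (w_opt : primal_global_optimum alpha psi phi nu (xi, w)) :
  (forall j, j \in index_J n_gt0 alpha ->
     w 0 j = (psi 0 j + sigma0 n_gt0 alpha * phi 0 j)
             / (alpha 0 j + sigma0 n_gt0 alpha))
  /\
  \sum_(i in index_I n_gt0 alpha) (2^-1 * w 0 i ^+ 2 - phi 0 i * w 0 i)
  = - (\sum_(j in index_J n_gt0 alpha) (2^-1 * w 0 j ^+ 2 - phi 0 j * w 0 j))
    + sigma0 n_gt0 alpha + nu.
Proof.
set s := sigma0 n_gt0 alpha.
have a_ge0 i : 0 <= alpha 0 i + s by exact: alphaD_sigma0_ge0.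
have dual_le := dual_le_lagrangian_sigma0 dual_sup_at_sigma0.
have [i0] := index_I_neq0 n_gt0 alpha.
rewrite inE -/s => /eqP a_i0.
have b_I i : alpha 0 i + s = 0 -> psi 0 i + s * phi 0 i = 0.
  apply: (@linear_residual_eq0 _ _ _ _ _ nu _
            (dual_objective alpha psi phi nu (s + 1))) => u.
  by apply: dual_le; rewrite ltrDl.
(* On [I] criticality leaves the value free; [phi] is the choice that minimizes the summands of
   [Lambda]. *)
pose v : 'rV[R]_n := \row_i if alpha 0 i + s == 0 then phi 0 i
                            else (psi 0 i + s * phi 0 i) / (alpha 0 i + s).
have v_I i : alpha 0 i + s = 0 -> v 0 i = phi 0 i.
  by move=> ai; rewrite mxE ai eqxx.
have v_crit i : psi 0 i + s * phi 0 i = (alpha 0 i + s) * v 0 i.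
  rewrite mxE; case: eqP => [ai|/eqP ai]; first by rewrite b_I // ai mul0r.
  by rewrite [RHS]mulrC divfK.
have Lambda_v : Lambda phi nu v - s <= 0.
  apply: le0_of_le_scaled => t t_gt0.
  have := dual_ge_first_order nu a_ge0 t_gt0 v_crit v_I.
  have s_lt : s < s + t by rewrite ltrDl.
  move=> /le_trans /(_ (dual_le _ v s_lt)).
  by rewrite lerBlDr lerD2l; exact.
(* A shift by [c] raises [Lambda] by [c^2 / 2], which must fill the gap [s - Lambda v], nonnegative
   by [Lambda_v]. *)
pose u := v + Num.sqrt (2 * (s - Lambda phi nu v)) *: delta_mx 0 i0.
have Lambda_u : Lambda phi nu u = s.
  rewrite Lambda_shift ?v_I // sqr_sqrtr; last by lra.
  by field.
have lag_u : lagrangian alpha psi phi nu s u = lagrangian alpha psi phi nu s v.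
  by rewrite lagrangian_shift // b_I // mul0r subr0.
(* Optimality is tested against [u], whose primal value is [lagrangian s v]. *)
case: w_opt => xiE /(_ (Lambda phi nu u, u) erefl).
have -> : xi = Lambda phi nu w := xiE.
rewrite !(primal_objective_lagrangian _ _ _ _ s) lag_u Lambda_u subrr.
rewrite expr0n mulr0 addr0 (lagrangian_min _ _ v_crit) -addrA gerDl => le0.
have sum_ge0 : forall i, true ->
    0 <= 2^-1 * (alpha 0 i + s) * (w 0 i - v 0 i) ^+ 2.
  by move=> i _; apply: mulr_ge0 (sqr_ge0 _); rewrite mulr_ge0 ?invr_ge0.
have Lambda_ge0 := sqr_ge0 (Lambda phi nu w - s).
have S_ge0 := sumr_ge0 (index_enum _) sum_ge0.
have /(psumr_eq0P sum_ge0) w_eq :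
    \sum_(i < n) 2^-1 * (alpha 0 i + s) * (w 0 i - v 0 i) ^+ 2 = 0 by lra.
have /eqP : (Lambda phi nu w - s) ^+ 2 = 0 by lra.
rewrite sqrf_eq0 subr_eq0 => /eqP Lambda_w.
split=> [j|].
  rewrite !inE -/s => aj; have /eqP := w_eq j isT.
  rewrite mulf_eq0 sqrf_eq0 mulf_eq0 invr_eq0 pnatr_eq0 (negPf aj) /= subr_eq0.
  move=> /eqP ->.
  by rewrite mxE (negPf aj).
(* The second claim is [Lambda w = s] with the sum split over [I] and [J]. *)
have := Lambda_w; rewrite /Lambda (bigID (mem (index_I n_gt0 alpha))) /=.
rewrite [X in _ + X - _](eq_bigl (mem (index_J n_gt0 alpha))) => [<-|i].
  by ring.
by rewrite !inE.
Qed.
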